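(* Let $\{N^f_\mu(t)\}_{t\ge 0}$, $N^f_\mu(t)=N(D^f(G_\mu(t)))$, be the geometric subordinated Poisson process. Let $Y_1,Y_2,\dots$ be i.i.d. random variables with the same distribution as the subordinated Poisson random variable $N^f(1)$, independent of the geometric counting process $\{G_\mu(t)\}_{t\ge0}$. Then for every $t\ge0$, $$N^f_\mu(t)\stackrel{d}{=}\sum_{i=1}^{G_\mu(t)}Y_i,$$ where $\stackrel{d}{=}$ denotes equality in distribution and an empty sum is $0$.
   Context: $\{D^f(t)\}_{t\ge0}$ is a Lévy subordinator (non-decreasing Lévy process) with Laplace transform $\mathbb{E}[e^{-sD^f(t)}]=e^{-tf(s)}$, where $f(s)=bs+\int_0^\infty(1-e^{-sx})\,\nu(dx)$, $b\ge0$, is a Bernstein function, and $\nu$ is a Lévy measure on the positive half-line with $\int_0^\infty (x\wedge 1)\,\nu(dx)<\infty$ and infinite total mass. $\{N(t)\}_{t\ge0}$ is a homogeneous Poisson process with intensity $\lambda>0$, independent of $D^f$. The subordinated Poisson process is $N^f(t)=N(D^f(t))$. The geometric counting process $\{G_\mu(t)\}_{t\ge0}$ with parameter $\mu>0$ is the mixed Poisson process whose random rate is exponentially distributed with mean $\mu$; it satisfies $G_\mu(0)=0$, has stationary increments, and $\mathbb{P}[G_\mu(t)=k]=\frac{1}{1+\mu t}\left(\frac{\mu t}{1+\mu t}\right)^k$ for $k=0,1,2,\dots$. The geometric subordinated Poisson process is $N^f_\mu(t):=N^f(G_\mu(t))$, $t\ge 0$, where $G_\mu$ is independent of $N^f$.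 *)

(* Defs.v *)
From HB Require Import structures.
From mathcomp Require Import all_boot all_order all_algebra.
From mathcomp Require Import all_classical all_reals all_analysis.

Set Implicit Arguments.
Unset Strict Implicit.
Unset Printing Implicit Defensive.

Import Order.TTheory GRing.Theory Num.Theory.
Import numFieldNormedType.Exports.

Local Open Scope classical_set_scope.
Local Open Scope ring_scope.

Section laws.
Context d (T : measurableType d) (R : realType) (P : probability T R).

Definition has_law d' (T' : measurableType d') (X : T -> T')
    (m : set T' -> \bar R) : Prop :=
  measurable_fun [set: T] X /\
  forall A, measurable A -> P (X @^-1` A) = m A.

Definition eq_in_law d' (T' : measurableType d') (X Y : T -> T') : Prop :=
  [/\ measurable_fun [set: T] X, measurable_fun [set: T] Y &
      forall A, measurable A -> P (X @^-1` A) = P (Y @^-1` A)].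

(* Product rule over every finite subfamily. *)
Definition mutually_independent d' (T' : measurableType d') (I : eqType)
    (X : I -> T -> T') : Prop :=
  forall (s : seq I) (A : I -> set T'), uniq s ->
    (forall i, measurable (A i)) ->
    P (\bigcap_(i in [set` s]) (X i @^-1` A i)) =
    (\prod_(i <- s) P (X i @^-1` A i))%E.

Definition generated_sigma_algebra d' (T' : measurableType d') (I : Type)
    (J : set I) (X : I -> T -> T') : set (set T) :=
  <<s \bigcup_(i in J) g_sigma_algebra_preimage (X i) >>.

Definition independent_sigma_algebras (F G : set (set T)) : Prop :=
  forall A B, F A -> G B -> P (A `&` B) = (P A * P B)%E.

End laws.

(* A process is a family indexed by R of which only the indices t >= 0 are
   meaningful. Path properties are required for every w, so that the composed
   processes below are random variables without completing P. *)
Section processes.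
Context d (T : measurableType d) (R : realType) (P : probability T R).

Definition process_sigma_algebra d' (T' : measurableType d')
    (X : R -> T -> T') : set (set T) :=
  generated_sigma_algebra [set t | 0 <= t] X.

Definition independent_processes d1 d2 (T1 : measurableType d1)
    (T2 : measurableType d2) (X : R -> T -> T1) (Y : R -> T -> T2) : Prop :=
  independent_sigma_algebras P
    (process_sigma_algebra X) (process_sigma_algebra Y).

Definition cadlag (x : R -> R) : Prop :=
  (forall t : R, 0 <= t -> x s @[s --> t^'+] --> x t) /\
  (forall t : R, 0 < t -> cvg (x s @[s --> t^'-])).

(* Quantifying over infinite nondecreasing time sequences covers all finite
   ones, as mutual independence only involves finite subfamilies. *)
Definition independent_increments (X : R -> T -> R) : Prop :=
  forall t : nat -> R, 0 <= t 0%N ->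
    (forall i, t i <= t i.+1) ->
    mutually_independent P (fun i w => X (t i.+1) w - X (t i) w).

Definition stationary_increments (X : R -> T -> R) : Prop :=
  forall s t : R, 0 <= s -> 0 <= t ->
    eq_in_law P (fun w => X (s + t) w - X s w) (fun w => X t w - X 0 w).

Record levy_process (X : R -> T -> R) : Prop := LevyProcess {
  levy_measurable : forall t : R, 0 <= t -> measurable_fun [set: T] (X t) ;
  levy_0 : forall w, X 0 w = 0 ;
  levy_cadlag : forall w, cadlag (X ^~ w) ;
  levy_independent : independent_increments X ;
  levy_stationary : stationary_increments X }.

Record levy_measure_pos (nu : {measure set R -> \bar R})
    : Prop := LevyMeasurePos {
  levy_measure_pos_support : nu `]-oo, 0]%classic = 0%E ;
  levy_measure_pos_integrable :
    (\int[nu]_(x in `]0%R, +oo[) (Num.min x 1)%:E < +oo)%E }.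

Definition bernstein_fun (b : R)
    (nu : {measure set R -> \bar R}) (s : R) : R :=
  b * s + \int[nu]_(x in `]0, +oo[) (1 - expR (- (s * x))).

Record levy_subordinator (f : R -> R) (D : R -> T -> R) : Prop :=
  LevySubordinator {
  subordinator_levy : levy_process D ;
  subordinator_nondecreasing :
    forall w (s t : R), 0 <= s -> s <= t -> D s w <= D t w ;
  subordinator_laplace : forall s t : R, 0 <= s -> 0 <= t ->
    ('E_P[fun w => expR (- (s * D t w))] = (expR (- (t * f s)))%:E)%E }.

Record counting_process (N : R -> T -> nat) : Prop := CountingProcess {
  counting_measurable : forall t : R, 0 <= t -> measurable_fun [set: T] (N t) ;
  counting_0 : forall w, N 0 w = 0%N ;
  counting_nondecreasing :
    forall w (s t : R), 0 <= s -> s <= t -> (N s w <= N t w)%N ;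
  counting_cadlag : forall w, cadlag (fun t => (N t w)%:R) }.

(* [poisson_prob r k] does not depend on k, and is the Dirac mass at 0 when
   r = 0 (whereas [poisson_pmf 0 k] is 1 for all k). *)
Definition poisson_law (r : R) : set nat -> \bar R := poisson_prob r 0%N.

Record poisson_process (lambda : R) (N : R -> T -> nat) : Prop :=
  PoissonProcess {
  poisson_counting : counting_process N ;
  poisson_levy : levy_process (fun t w => (N t w)%:R) ;
  poisson_marginal : forall t : R, 0 <= t ->
    has_law P (N t) (poisson_law (lambda * t)) }.

(* There is a random rate L with law U given which N is a Poisson process of
   rate L: the conditional probability given L that the increments of N over
   [t_i, t_(i+1)] are k_i, i < n, is the product of the Poisson probabilities,
   integrated here over the events {L in B} generating sigma(L). *)
Record mixed_poisson_process (U : set R -> \bar R) (N : R -> T -> nat)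
    : Prop := MixedPoissonProcess {
  mixed_poisson_counting : counting_process N ;
  mixed_poisson_rate : exists2 L : T -> R, has_law P L U &
    forall (n : nat) (t : nat -> R) (k : nat -> nat) (B : set R),
      0 <= t 0%N -> (forall i, t i <= t i.+1) -> measurable B ->
      P (L @^-1` B `&`
         [set w | forall i, (i < n)%N -> N (t i.+1) w = (N (t i) w + k i)%N]) =
      (\int[P]_(w in L @^-1` B)
         \prod_(i < n) poisson_law (L w * (t i.+1 - t i)) [set k i])%E }.

(* [exponential_prob r] has mean r^-1. *)
Definition geometric_counting_process (mu : R) (G : R -> T -> nat) : Prop :=
  mixed_poisson_process (exponential_prob mu^-1) G.

Definition subordinated_poisson (N : R -> T -> nat) (D : R -> T -> R)
    : R -> T -> nat :=
  fun t w => N (D t w) w.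

Definition geometric_subordinated_poisson (N : R -> T -> nat)
    (D : R -> T -> R) (G : R -> T -> nat) : R -> T -> nat :=
  fun t w => subordinated_poisson N D (G t w)%:R w.

End processes.

(* Main.v *)
(* Both sides are sums indexed by [G t]: by independence it suffices to show
   that [N (D n)] and [Y_0 + ... + Y_(n-1)] have the same law for every integer
   [n], which is read off their probability generating functions. The subordinated
   Poisson variable satisfies [E[z^N(D t)] = E[exp(- lambda (1 - z) D t)]], which
   the Laplace transform of [D] turns into [exp(- t f(lambda (1 - z)))]; at [t = n]
   this is the [n]-th power of its value at [t = 1]. The first identity is clear
   when [D t] takes countably many values, and follows in general by approximating
   [D t] strictly from above by grid points, as [N] is right-continuous. *)

Require Import Defs.
From HB Require Import structures.
From mathcomp Require Import all_boot all_order all_algebra.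
From mathcomp Require Import all_classical all_reals all_analysis.
From mathcomp Require Import measurable_realfun ring lra.

Set Implicit Arguments.
Unset Strict Implicit.
Unset Printing Implicit Defensive.

Import Order.TTheory GRing.Theory Num.Theory.
Import numFieldNormedType.Exports.

Local Open Scope classical_set_scope.
Local Open Scope ring_scope.

(** * Natural-number-valued random variables, decomposed along their countable fibers *)

Section nat_valued.
Context d (T : measurableType d) (R : realType) (P : probability T R).
Implicit Types (X : T -> nat) (Z : nat -> T -> nat) (B : set T) (z : R).
Local Open Scope ereal_scope.

Lemma measurable_nat_preimage X (A : set nat) :
  measurable_fun setT X -> measurable (X @^-1` A).
Proof. by move=> mX; rewrite -[_ @^-1` _]setTI; exact: mX. Qed.

Lemma measurable_nat_fibers X :
  (forall k, measurable (X @^-1` [set k])) -> measurable_fun setT X.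
Proof.
move=> mX _ A _; rewrite setTI.
rewrite (_ : _ @^-1` _ = \bigcup_(k in A) X @^-1` [set k]).
  by apply: bigcup_measurable => k _; exact: mX.
by apply/seteqP; split=> [w Aw|w [k Ak /= ->]] //; exists (X w).
Qed.

Lemma nat_fibers_partition X B : B = \bigcup_k (B `&` X @^-1` [set k]).
Proof.
by apply/seteqP; split=> [w Bw|w [k _ [? _]]] //; exists (X w).
Qed.

Lemma trivIset_nat_fibers X B : trivIset setT (fun k => B `&` X @^-1` [set k]).
Proof. by move=> i j _ _ [w [[_ /= <-] [_ /= <-]]]. Qed.

Lemma probability_nat_fibers X B : measurable_fun setT X -> measurable B ->
  P B = \sum_(0 <= k <oo) P (B `&` X @^-1` [set k]).
Proof.
move=> mX mB; rewrite {1}(nat_fibers_partition X B) measure_bigcup//.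
- by apply: eq_eseriesl => k; rewrite in_setT.
- by move=> k _; apply: measurableI => //; exact: measurable_nat_preimage.
- exact: trivIset_nat_fibers.
Qed.

Lemma integral_nat_fibers X B (f : T -> \bar R) :
  measurable_fun setT X -> measurable B -> measurable_fun setT f ->
  (forall w, 0 <= f w) ->
  \int[P]_(w in B) f w =
  \sum_(0 <= k <oo) \int[P]_(w in B `&` X @^-1` [set k]) f w.
Proof.
move=> mX mB mf f0; rewrite {1}(nat_fibers_partition X B).
rewrite ge0_integral_bigcup//.
- by move=> k; apply: measurableI => //; exact: measurable_nat_preimage.
- exact: measurable_funTS.
- exact: trivIset_nat_fibers.
Qed.

Lemma measurable_nat_comp d' (T' : measurableType d') X (g : nat -> T') :
  measurable_fun setT X -> measurable_fun setT (g \o X).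
Proof.
by move=> mX _ A _; rewrite setTI comp_preimage; exact: measurable_nat_preimage.
Qed.

Lemma integral_nat_comp X B (g : nat -> \bar R) :
  measurable_fun setT X -> measurable B -> (forall k, 0 <= g k) ->
  \int[P]_(w in B) g (X w) =
  \sum_(0 <= k <oo) g k * P (B `&` X @^-1` [set k]).
Proof.
move=> mX mB g0; rewrite (integral_nat_fibers mX)//; last first.
  exact: measurable_nat_comp.
apply: eq_eseriesr => k _; rewrite -integral_cst; last first.
  by apply: measurableI => //; exact: measurable_nat_preimage.
by apply: eq_integral => w /set_mem[_ /= ->].
Qed.

(** Independence of [B] from the single fibers of [X] is enough, since the integral is a series over
    these fibers from which the factor [P B] comes out. *)
Lemma integral_nat_comp_indep X B (g : nat -> \bar R) :
  measurable_fun setT X -> measurable B -> (forall k, 0 <= g k) ->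
  (forall k, P (B `&` X @^-1` [set k]) = P B * P (X @^-1` [set k])) ->
  \int[P]_(w in B) g (X w) = P B * \int[P]_w g (X w).
Proof.
move=> mX mB g0 indep; rewrite !integral_nat_comp//.
rewrite -(fineK (fin_num_measure P B mB)) -nneseriesZl//; last first.
  by move=> k _; rewrite mule_ge0.
rewrite fineK ?fin_num_measure//.
by apply: eq_eseriesr => k _; rewrite indep setTI muleCA.
Qed.

Lemma measurable_random_index X Z : measurable_fun setT X ->
  (forall n, measurable_fun setT (Z n)) ->
  measurable_fun setT (fun w => Z (X w) w).
Proof.
move=> mX mZ _ A _; rewrite setTI (nat_fibers_partition X (_ @^-1` _)).
apply: bigcup_measurable => k _.
rewrite (_ : _ `&` _ = Z k @^-1` A `&` X @^-1` [set k]).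
  by apply: measurableI; exact: measurable_nat_preimage.
by apply/seteqP; split=> w [/= + Xw]; rewrite Xw.
Qed.

(** On [X = n] the variable is [Z n], and independence splits each term. Both sides of the theorem
    have this form, with [G t] for [X]. *)
Lemma probability_random_index X Z (A : set nat) : measurable_fun setT X ->
  (forall n, measurable_fun setT (Z n)) ->
  (forall n, P (X @^-1` [set n] `&` Z n @^-1` A) =
             P (X @^-1` [set n]) * P (Z n @^-1` A)) ->
  P ((fun w => Z (X w) w) @^-1` A) =
  \sum_(0 <= n <oo) P (X @^-1` [set n]) * P (Z n @^-1` A).
Proof.
move=> mX mZ indep; rewrite (probability_nat_fibers mX); last first.
  by apply: measurable_nat_preimage; exact: measurable_random_index.
apply: eq_eseriesr => n _; rewrite -indep setIC; congr (P _).
by apply/seteqP; split=> w [/= Xw]; rewrite Xw.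
Qed.

Lemma integral_random_index X Z (g : nat -> \bar R) : measurable_fun setT X ->
  (forall n, measurable_fun setT (Z n)) -> (forall k, 0 <= g k) ->
  (forall n k, P (X @^-1` [set n] `&` Z n @^-1` [set k]) =
               P (X @^-1` [set n]) * P (Z n @^-1` [set k])) ->
  \int[P]_w g (Z (X w) w) =
  \sum_(0 <= n <oo) (\int[P]_w g (Z n w)) * P (X @^-1` [set n]).
Proof.
move=> mX mZ g0 indep; rewrite (integral_nat_fibers mX)//; last first.
  by apply: (measurable_nat_comp g); exact: measurable_random_index.
apply: eq_eseriesr => n _; rewrite setTI muleC -integral_nat_comp_indep//.
- by apply: eq_integral => w /set_mem /= ->.
- exact: measurable_nat_preimage.
Qed.

(** * Probability generating functions and the fact that they determine the law *)

Definition pgf X z : \bar R := \int[P]_w (z ^+ X w)%:E.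

Lemma pgf_series X z : measurable_fun setT X -> (0 <= z)%R ->
  pgf X z = \sum_(0 <= k <oo) (z ^+ k)%:E * P (X @^-1` [set k]).
Proof.
move=> mX z0; rewrite /pgf (@integral_nat_comp X setT (fun k => (z ^+ k)%:E))//.
  by apply: eq_eseriesr => k _; rewrite setTI.
by move=> k; rewrite lee_fin exprn_ge0.
Qed.

Lemma eq_in_law_pgf X X' z : (0 <= z)%R -> eq_in_law P X X' ->
  pgf X z = pgf X' z.
Proof.
move=> z0 [mX mX' XX']; rewrite !pgf_series//.
by apply: eq_eseriesr => k _; rewrite XX'.
Qed.

Lemma pgf_ge_head X z n : measurable_fun setT X -> (0 <= z)%R ->
  (\sum_(0 <= k < n) z ^+ k * fine (P (X @^-1` [set k])))%:E <= pgf X z.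
Proof.
move=> mX z0; rewrite pgf_series// -sumEFin.
rewrite [leLHS](_ : _ =
    \sum_(0 <= k < n) (z ^+ k)%:E * P (X @^-1` [set k])); last first.
  apply: eq_bigr => k _; rewrite EFinM fineK// fin_num_measure//.
  exact: measurable_nat_preimage.
by apply: nneseries_lim_ge => k _; rewrite mule_ge0// lee_fin exprn_ge0.
Qed.

(** From index [n] on, each [z ^+ k] is at most [z ^+ n], and the mass that [X] puts there is at
    most 1. *)
Lemma pgf_le_head X z n : measurable_fun setT X -> (0 <= z <= 1)%R ->
  pgf X z <=
  (\sum_(0 <= k < n) z ^+ k * fine (P (X @^-1` [set k])) + z ^+ n)%:E.
Proof.
move=> mX /andP[z0 z1].
have zk0 k : 0 <= (z ^+ k)%:E * P (X @^-1` [set k]).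
  by rewrite mule_ge0// lee_fin exprn_ge0.
rewrite pgf_series// (nneseries_split 0 n)//.
rewrite add0n EFinD; apply: leeD.
  rewrite -sumEFin le_eqVlt; apply/orP; left; apply/eqP.
  apply: eq_bigr => k _; rewrite EFinM fineK// fin_num_measure//.
  exact: measurable_nat_preimage.
apply: (@le_trans _ _
  (\sum_(n <= k <oo) (z ^+ n)%:E * P (X @^-1` [set k]))).
  rewrite eseries_cond [leRHS]eseries_cond.
  apply: lee_nneseries => [k _ _|k nk]; first exact: zk0.
  by rewrite lee_wpmul2r// lee_fin ler_wiXn2l.
rewrite nneseriesZl// -[leRHS]mule1; apply: lee_wpmul2l.
  by rewrite lee_fin exprn_ge0.
rewrite -(@probability_setT _ _ _ P) (probability_nat_fibers mX measurableT).
rewrite [leRHS](nneseries_split 0 n)// add0n.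
under [X in _ <= _ + X]eq_eseriesr do rewrite setTI.
by rewrite leeDr// sume_ge0.
Qed.

(* Comparing the terms of index at least [k] gives
   [P (X' = k) <= P (X = k) + z] for every [z] in ]0, 1]. *)
Lemma pgf_le_mass X X' k : measurable_fun setT X -> measurable_fun setT X' ->
  (forall z, (0 < z <= 1)%R -> pgf X z = pgf X' z) ->
  (forall i, (i < k)%N -> P (X @^-1` [set i]) = P (X' @^-1` [set i])) ->
  P (X' @^-1` [set k]) <= P (X @^-1` [set k]).
Proof.
move=> mX mX' eqz eqk.
have mk (Z : T -> nat) : measurable_fun setT Z -> P (Z @^-1` [set k]) \is a fin_num.
  by move=> mZ; rewrite fin_num_measure//; exact: measurable_nat_preimage.
rewrite -(fineK (mk _ mX)) -(fineK (mk _ mX')) lee_fin.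
apply/ler_addgt0Pl => e e0; pose z := Num.min e 1%R.
have z0 : (0 < z)%R by rewrite lt_min e0 ltr01.
have z1 : (z <= 1)%R by rewrite ge_min lexx orbT.
have ze : (z <= e)%R by rewrite ge_min lexx.
(* Heads of length [k.+1] keep the term of index [k] and leave a remainder [z ^+ k.+1], which is [z]
   once [z ^+ k] is divided out; the choice of [z] makes this at most [e]. *)
have := pgf_ge_head k.+1 mX' (ltW z0).
rewrite -eqz ?z0// => /le_trans.
have z01 : (0 <= z <= 1)%R by rewrite ltW.
move=> /(_ _ (pgf_le_head k.+1 mX z01)).
rewrite lee_fin !big_nat_recr//=.
under eq_big_nat => i ik do rewrite -eqk//.
rewrite -addrA lerD2l exprSr -mulrDr ler_pM2l ?exprn_gt0//.
by move=> /le_trans; apply; rewrite addrC lerD2r.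
Qed.

(** Strong induction on [k] identifies the masses of singletons, each equality coming from
    [pgf_le_mass] used in both directions; countable additivity then reaches every [A]. *)
Lemma pgf_inj X X' : measurable_fun setT X -> measurable_fun setT X' ->
  (forall z, (0 < z <= 1)%R -> pgf X z = pgf X' z) ->
  forall A, P (X @^-1` A) = P (X' @^-1` A).
Proof.
move=> mX mX' eqz.
have eqk k : P (X @^-1` [set k]) = P (X' @^-1` [set k]).
  elim/ltn_ind: k => k IH; apply/eqP; rewrite eq_le.
  apply/andP; split; apply: pgf_le_mass => // i ik; first by rewrite -eqz.
  by rewrite IH.
move=> A; rewrite (probability_nat_fibers mX) ?(probability_nat_fibers mX');
  try exact: measurable_nat_preimage.
apply: eq_eseriesr => k _.
have [Ak|nAk] := pselect (A k).
  by rewrite !(_ : forall Z : T -> nat, Z @^-1` A `&` Z @^-1` [set k] = Z @^-1` [set k])//;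
    move=> Z; apply/seteqP; split=> [w []//|w /= Zw]; rewrite Zw.
by rewrite !(_ : forall Z : T -> nat, Z @^-1` A `&` Z @^-1` [set k] = set0)//;
  move=> Z; apply/seteqP; split=> [w [/= AZ Zk]|//]; apply: nAk; rewrite -Zk.
Qed.

End nat_valued.

(** * Generating function of a sum of independent variables *)

Section sums.
Context d (T : measurableType d) (R : realType) (P : probability T R).
Local Open Scope ereal_scope.

(** The space [T'] is left arbitrary so that the lemma also applies when the sample space carries
    the sigma-algebra generated by the [Y i]. *)
Lemma measurable_nat_sum d' (T' : measurableType d') (Y : nat -> T' -> nat) n :
  (forall i, measurable_fun setT (Y i)) ->
  measurable_fun setT (fun w => \sum_(i < n) Y i w)%N.
Proof.
move=> mY; elim: n => [|n IH].
  by under eq_fun do rewrite big_ord0; exact: measurable_cst.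
under eq_fun do rewrite big_ord_recr/=.
apply: measurable_nat_fibers => k.
rewrite (nat_fibers_partition (Y n) (_ @^-1` _)).
apply: bigcup_measurable => j _.
rewrite (_ : _ `&` _ =
  (fun w => \sum_(i < n) Y i w)%N @^-1` [set i | (i + j = k)%N] `&`
  Y n @^-1` [set j]).
  by apply: measurableI; exact: measurable_nat_preimage.
by apply/seteqP; split=> w [/= + Yw]; rewrite Yw.
Qed.

(* The factor over [s], all of whose indices are at least [n], makes the
   induction on [n] go through. *)
Lemma pgf_sum_cond (Y : nat -> T -> nat) (z : R) (phi : R) n :
  (0 <= z)%R -> (forall i, measurable_fun setT (Y i)) ->
  mutually_independent P Y -> (forall i, pgf P (Y i) z = phi%:E) ->
  forall (s : seq nat) (A : nat -> set nat), uniq s ->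
  all (fun i => n <= i)%N s ->
  let B := \bigcap_(i in [set` s]) (Y i @^-1` A i) in
  \int[P]_(w in B) (z ^+ (\sum_(i < n) Y i w))%:E = (phi ^+ n)%:E * P B.
Proof.
move=> z0 mY indY pgfY; elim: n => [|n IH] s A us ns /=.
  rewrite expr0 -integral_cst.
    by apply: eq_integral => w _; rewrite big_ord0 expr0.
  by apply: bigcap_measurableType => i _; exact: measurable_nat_preimage.
set B := \bigcap_(i in _) _.
have mB : measurable B.
  by apply: bigcap_measurableType => i _; exact: measurable_nat_preimage.
have mz X : measurable_fun setT X ->
    measurable_fun setT (fun w : T => (z ^+ X w)%:E).
  by move=> mX; apply: (measurable_nat_comp (fun k => (z ^+ k)%:E)).
rewrite (integral_nat_fibers _ (mY n))//; last 2 first.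
- exact/mz/measurable_nat_sum.
- by move=> w; rewrite lee_fin exprn_ge0.
have ns' : n \notin s.
  by apply/negP => /(allP ns); rewrite ltnn.
(* The generating function [phi] of [Y n] is expanded over the values [k] of [Y n], to be compared
   term by term with the splitting of the integral. *)
transitivity (\sum_(0 <= k <oo)
  (phi ^+ n)%:E * P B * ((z ^+ k)%:E * P (Y n @^-1` [set k]))); last first.
  rewrite -{1}(fineK (fin_num_measure P B mB)) -EFinM nneseriesZl//.
    rewrite EFinM fineK ?fin_num_measure//; have := integral_nat_comp P (mY n) measurableT
      (g := fun k => (z ^+ k)%:E).
    rewrite -/(pgf P (Y n) z) pgfY.
    under eq_eseriesr do rewrite setTI.
    move=> <-; last by move=> k; rewrite lee_fin exprn_ge0.
    by rewrite exprSr EFinM muleAC.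
  by move=> k _; rewrite mule_ge0// lee_fin exprn_ge0.
apply: eq_eseriesr => k _.
(* The constraint [Y n = k] joins those over [s], whose indices all exceed [n]; the new event is
   indexed by [n :: s], to which the induction hypothesis applies. *)
pose A' i := if i == n then [set k] else A i.
have BE : B `&` Y n @^-1` [set k] =
    \bigcap_(i in [set` n :: s]) (Y i @^-1` A' i).
  apply/seteqP; split=> [w [Bw Yw] i /=|w Bw].
    rewrite inE /A' => /predU1P[->|si]; first by rewrite eqxx.
    case: eqP => [ein|_]; first by rewrite ein in si; rewrite si in ns'.
    exact: Bw.
  split; last by have := Bw n; rewrite /= mem_head /A' eqxx; exact.
  move=> i /= si; have := Bw i; rewrite /= inE si orbT /A'.
  case: eqP => [ein|_]; first by rewrite ein in si; rewrite si in ns'.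
  exact.
have PB : P (B `&` Y n @^-1` [set k]) = P B * P (Y n @^-1` [set k]).
  rewrite BE indY/= ?ns'//.
  rewrite big_cons {1}/A' eqxx muleC indY//; congr (_ * _).
  apply: eq_big_seq => i si; rewrite /A'.
  by case: eqP => [ein|//]; rewrite ein in si; rewrite si in ns'.
transitivity (\int[P]_(w in B `&` Y n @^-1` [set k])
  ((z ^+ k)%:E * (z ^+ (\sum_(i < n) Y i w))%:E)).
  apply: eq_integral => w /set_mem[_ /= Yw].
  by rewrite big_ord_recr/= Yw addnC exprD EFinM.
rewrite ge0_integralZl//; last 4 first.
- by apply: measurableI => //; exact: measurable_nat_preimage.
- by apply: measurable_funTS; exact/mz/measurable_nat_sum.
- by move=> w _; rewrite lee_fin exprn_ge0.
- by rewrite lee_fin exprn_ge0.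
rewrite BE IH/=; last 2 first.
- by rewrite ns'.
- by rewrite leqnn/=; apply: sub_all ns => i; exact: ltnW.
rewrite -BE PB !muleA; congr (_ * _).
by rewrite -muleA muleC.
Qed.

Lemma pgf_sum (Y : nat -> T -> nat) (z : R) (phi : R) n :
  (0 <= z)%R -> (forall i, measurable_fun setT (Y i)) ->
  mutually_independent P Y -> (forall i, pgf P (Y i) z = phi%:E) ->
  pgf P (fun w => \sum_(i < n) Y i w)%N z = (phi ^+ n)%:E.
Proof.
move=> z0 mY indY pgfY.
have := pgf_sum_cond (n := n) z0 mY indY pgfY (fun=> setT) (s := [::]) isT isT.
by rewrite /= set_nil bigcap_set0 probability_setT mule1.
Qed.

End sums.

(** * Approximation of a time strictly from above by points of a grid of mesh [1 / m.+1] *)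

Section grid.
Context (R : realType).
Implicit Types (u : R) (m k : nat).

Definition grid_index m u : nat := Num.truncn (u * m.+1%:R).

(** The right end of the half-open cell of index [k]: it lies strictly above every time in the cell,
    as an approach from the right requires. *)
Definition grid_point m k : R := k.+1%:R / m.+1%:R.

Lemma grid_point_ge0 m k : 0 <= grid_point m k.
Proof. by rewrite divr_ge0. Qed.

Lemma grid_index_fiber m k u : 0 <= u ->
  (grid_index m u = k) <->
  u \in `[k%:R / m.+1%:R, k.+1%:R / m.+1%:R[.
Proof.
move=> u0; rewrite in_itv/= ler_pdivrMr// ltr_pdivlMr//.
have um0 : 0 <= u * m.+1%:R by rewrite mulr_ge0.
split=> [<-|]; first exact: truncn_itv.
by move=> /truncn_def.
Qed.

Lemma grid_point_gt m u : 0 <= u -> u < grid_point m (grid_index m u).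
Proof.
move=> u0; rewrite ltr_pdivlMr//.
by have /truncn_itv/andP[] : 0 <= u * m.+1%:R by rewrite mulr_ge0.
Qed.

Lemma grid_point_le m u : 0 <= u ->
  grid_point m (grid_index m u) <= u + m.+1%:R^-1.
Proof.
move=> u0; rewrite ler_pdivrMr// mulrDl mulVf// -natr1 lerD2r.
by have /truncn_itv/andP[] : 0 <= u * m.+1%:R by rewrite mulr_ge0.
Qed.

Lemma cvg_grid_point u : 0 <= u ->
  grid_point m (grid_index m u) @[m --> \oo] --> u.
Proof.
move=> u0; apply: (@squeeze_cvgr _ _ _ _ (cst u) (fun m => u + m.+1%:R^-1)).
- by near=> m; rewrite /= ltW ?grid_point_gt//= grid_point_le.
- exact: cvg_cst.
- rewrite -[X in _ --> X]addr0; apply: cvgD; first exact: cvg_cst.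
  exact: cvg_harmonic.
Unshelve. all: by end_near. Qed.

End grid.

(** Two natural numbers at distance less than 1 are equal. *)
Lemma cvg_natr_near (R : realType) (u : nat -> nat) (l : nat) :
  (u m)%:R @[m --> \oo] --> (l%:R : R) -> \forall m \near \oo, u m = l.
Proof.
move=> /cvgr_dist_lt /(_ 1 ltr01); apply: filterS => m.
rewrite ltr_distlC => /andP[ul lu].
apply/eqP; rewrite eqn_leq -(ltnS (u m)) -(ltnS l) -!(ltr_nat R) -!natr1.
by apply/andP; split; lra.
Qed.

(** * A process evaluated at an independent random time *)

Section random_time.
Context d (T : measurableType d) (R : realType) (P : probability T R).
(** In the application [N] is the Poisson process, [U] is [D t] for a fixed [t], and [a z] is
    [lambda * (1 - z)]. *)
Variables (N : R -> T -> nat) (U : T -> R) (a : R -> R).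
Hypothesis mN : forall u : R, 0 <= u -> measurable_fun setT (N u).
Hypothesis N_right_cont : forall w (u : R), 0 <= u ->
  (N s w)%:R @[s --> u^'+] --> ((N u w)%:R : R).
Hypothesis pgfN : forall z u : R, 0 < z <= 1 -> 0 <= u ->
  pgf P (N u) z = (expR (- (a z * u)))%:E.
Hypothesis mU : measurable_fun setT U.
Hypothesis U0 : forall w, 0 <= U w.
Hypothesis indepNU : forall (u : R) (A : set R) k, 0 <= u -> measurable A ->
  P (U @^-1` A `&` N u @^-1` [set k]) =
  (P (U @^-1` A) * P (N u @^-1` [set k]))%E.

Let X m w := grid_index m (U w).
Let V m w := grid_point R m (X m w).

Let fiberX m k : X m @^-1` [set k] =
  U @^-1` [set` `[(k%:R : R) / m.+1%:R, k.+1%:R / m.+1%:R[].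
Proof. by apply/seteqP; split=> w /=; rewrite /X grid_index_fiber. Qed.

Let mX m : measurable_fun setT (X m).
Proof.
apply: measurable_nat_fibers => k; rewrite fiberX -[_ @^-1` _]setTI.
exact: mU.
Qed.

Let mNV m : measurable_fun setT (fun w => N (V m w) w).
Proof.
apply: (@measurable_random_index _ _ (X m) (fun k => N (grid_point R m k))) => //.
by move=> k; apply: mN; exact: grid_point_ge0.
Qed.

(** The times [V m w] tend to [U w] from strictly above, so right-continuity gives convergence of
    the values; being integers, they are eventually constant. *)
Let near_NV w : \forall m \near \oo, N (V m w) w = N (U w) w.
Proof.
apply: (@cvg_natr_near R).
apply: ((cvg_at_rightP _ _ _).1 (@N_right_cont w _ (U0 w)) (V ^~ w)); split.
  by move=> m; exact: grid_point_gt.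
exact: cvg_grid_point.
Qed.

(** Viewed in [R], the variable is the pointwise limit of the measurable variables [N (V m w) w]. *)
Lemma measurable_random_time : measurable_fun setT (fun w => N (U w) w).
Proof.
have mNR : measurable_fun setT (fun w => (N (U w) w)%:R : R).
  apply: (@measurable_fun_cvg _ _ _ _ (fun m w => (N (V m w) w)%:R)).
    by move=> m; apply: (measurable_nat_comp (fun n => n%:R : R)).
  move=> w _; apply: cvg_near_cst.
  by apply: filterS (near_NV w) => m ->.
apply: measurable_nat_fibers => k.
rewrite (_ : _ @^-1` _ = (fun w => (N (U w) w)%:R : R) @^-1` [set k%:R]).
  by rewrite -[_ @^-1` _]setTI; exact: mNR.
by apply/seteqP; split=> w /= => [->|/eqP]//; rewrite eqr_nat => /eqP.
Qed.

(** On [X m = k] the time is the constant [grid_point R m k], and this event depends on [U] only;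
    independence allows [pgfN] to be applied at each grid point. *)
Let pgf_grid m z : 0 < z <= 1 ->
  pgf P (fun w => N (V m w) w) z = (\int[P]_w (expR (- (a z * V m w)))%:E)%E.
Proof.
move=> z01; have /andP[/ltW z0 _] := z01.
rewrite /pgf (integral_random_index (Z := fun k => N (grid_point R m k))
  (g := fun k => (z ^+ k)%:E) (mX m)).
- rewrite (@integral_nat_comp _ _ _ _ _ _
    (fun k => (expR (- (a z * grid_point R m k)))%:E))//.
  apply: eq_eseriesr => k _.
  by rewrite -/(pgf _ _ _) pgfN// ?grid_point_ge0// setTI.
- by move=> k; apply: mN; exact: grid_point_ge0.
- by move=> k; rewrite lee_fin exprn_ge0.
- by move=> n k; rewrite fiberX indepNU ?grid_point_ge0.
Qed.

(** Both sides of [pgf_grid] pass to the limit by dominated convergence; the constant 1 dominates,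
    thanks to [z <= 1] on one side and [0 <= a z] on the other. *)
Lemma pgf_random_time z : 0 < z <= 1 -> 0 <= a z ->
  pgf P (fun w => N (U w) w) z = (\int[P]_w (expR (- (a z * U w)))%:E)%E.
Proof.
move=> z01 az0; have /andP[/ltW z0 z1] := z01.
have i1 : P.-integrable setT (cst 1%E : T -> \bar R).
  exact: finite_measure_integrable_cst.
have gridE : (fun m => pgf P (fun w => N (V m w) w) z) =
    (fun m => \int[P]_w (expR (- (a z * V m w)))%:E)%E.
  by apply/funext => m; exact: pgf_grid.
have cvgE : (\int[P]_w (expR (- (a z * V m w)))%:E)%E @[m --> \oo] -->
    (\int[P]_w (expR (- (a z * U w)))%:E)%E.
  apply: (@dominated_cvg _ _ _ P setT measurableT _ _ (cst 1%E)) => //.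
  - move=> m; apply: (@measurable_nat_comp _ _ _ _ (X m)
      (fun k => (expR (- (a z * grid_point R m k)))%:E)).
    exact: mX.
  - move=> w _; apply/fine_cvgP; split; first exact: nearW.
    have cV : - (a z * V m w) @[m --> \oo] --> - (a z * U w).
      under eq_fun do rewrite -mulNr; rewrite -mulNr.
      by apply: cvgMl_tmp; exact: cvg_grid_point.
    by apply: (cvg_comp _ expR cV); exact: continuous_expR.
  - move=> m w _; rewrite gee0_abs ?lee_fin ?expR_ge0// -expR0 ler_expR.
    by rewrite oppr_le0 mulr_ge0// grid_point_ge0.
have cvgN : pgf P (fun w => N (V m w) w) z @[m --> \oo] -->
    pgf P (fun w => N (U w) w) z.
  apply: (@dominated_cvg _ _ _ P setT measurableT _ _ (cst 1%E)) => //.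
  - move=> m; apply: (measurable_nat_comp (fun k => (z ^+ k)%:E)).
    exact: mNV.
  - move=> w _; apply: cvg_near_cst; apply: filterS (near_NV w) => m.
    by move=> ->.
  - move=> m w _; rewrite gee0_abs ?lee_fin ?exprn_ge0//.
    by rewrite exprn_ile1.
rewrite -gridE in cvgE.
exact: cvg_unique cvgN cvgE.
Qed.

End random_time.

(** * Generating function of the Poisson law *)

Section poisson_pgf.
Context (R : realType).
Local Open Scope ereal_scope.

(** Exponential tilting: [z ^+ k] is absorbed into the power [r ^+ k], and the exponential is split
    by [r = r * (1 - z) + r * z]. For [r = 0] both laws are the Dirac mass at 0. *)
Lemma poisson_law_tilt (r z : R) k : (0 <= r)%R -> (0 < z)%R ->
  (z ^+ k)%:E * poisson_law r [set k] =
  (expR (- (r * (1 - z))))%:E * poisson_law (r * z) [set k].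
Proof.
move=> r0 z0; rewrite /poisson_law /poisson_prob pmulr_lgt0//.
have [r_gt0|r_le0] := ltP 0%R r; last first.
  have -> : r = 0%R by apply/eqP; rewrite eq_le r_le0.
  rewrite mul0r oppr0 expR0 mul1e; case: k => [|k]; first by rewrite mul1e.
  by rewrite diracE memNset ?mule0.
rewrite !esum_set1 ?lee_fin ?poisson_pmf_ge0// -!EFinM; congr EFin.
rewrite /poisson_pmf pmulr_lgt0// r_gt0 exprMn.
rewrite (_ : - r = - (r * (1 - z)) + - (r * z))%R ?expRD; last by ring.
by ring.
Qed.

(** After tilting, the series is the exponential factor times the total mass of the Poisson law of
    parameter [r * z]. *)
Lemma pgf_poisson d (T : measurableType d) (P : probability T R) X (r z : R) :
  (0 <= r)%R -> (0 < z)%R -> has_law P X (poisson_law r) ->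
  pgf P X z = (expR (- (r * (1 - z))))%:E.
Proof.
move=> r0 z0 [mX lawX]; rewrite pgf_series ?(ltW z0)//.
under eq_eseriesr do rewrite lawX// poisson_law_tilt//.
rewrite nneseriesZl//.
have := probability_nat_fibers (poisson_prob (r * z) 0) (X := id)
  (@measurable_id _ _ _) measurableT.
under eq_eseriesr do rewrite setTI preimage_id.
by rewrite probability_setT => <-; rewrite mule1.
Qed.

End poisson_pgf.

(** * Events belonging to generated sigma-algebras *)

Section sigma_algebras.
Context d (T : measurableType d) (R : realType).

Lemma generated_sigma_algebra_preimage d' (T' : measurableType d') (I : Type)
    (J : set I) (X : I -> T -> T') i (A : set T') : J i -> measurable A ->
  generated_sigma_algebra J X (X i @^-1` A).
Proof.
move=> Ji mA; apply: sub_gen_smallest; exists i => //.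
by exists A => //; rewrite setTI.
Qed.

Lemma process_sigma_algebra_preimage d' (T' : measurableType d')
    (X : R -> T -> T') (t : R) (A : set T') : 0 <= t -> measurable A ->
  process_sigma_algebra X (X t @^-1` A).
Proof. by move=> t0 mA; exact: generated_sigma_algebra_preimage. Qed.

Lemma generated_sigma_algebra_sum (Y : nat -> T -> nat) n (A : set nat) :
  generated_sigma_algebra setT Y ((fun w => \sum_(i < n) Y i w)%N @^-1` A).
Proof.
pose F := \bigcup_(i in setT) g_sigma_algebra_preimage (Y i).
(* With [T] equipped with the sigma-algebra generated by the [Y i], membership of the event becomes
   measurability of the sum. *)
have mY i : measurable_fun setT (Y i : g_sigma_algebraType F -> nat).
  move=> _ B mB; rewrite setTI.
  exact: (@generated_sigma_algebra_preimage _ _ _ setT Y i B).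
exact: (measurable_nat_preimage A (measurable_nat_sum n mY)).
Qed.

End sigma_algebras.

(** * The subordinated Poisson variable at a fixed time *)

Section subordination.
Context d (T : measurableType d) (R : realType) (P : probability T R).
Variables (f : R -> R) (lambda : R) (D : R -> T -> R) (N : R -> T -> nat).
Hypothesis D_subordinator : levy_subordinator P f D.
Hypothesis lambda_gt0 : 0 < lambda.
Hypothesis N_poisson : poisson_process P lambda N.
Hypothesis N_D_independent : independent_processes P N D.

Let mD t : 0 <= t -> measurable_fun setT (D t).
Proof. exact: levy_measurable (subordinator_levy D_subordinator) _. Qed.

Let D_ge0 t w : 0 <= t -> 0 <= D t w.
Proof.
move=> t0; rewrite -(levy_0 (subordinator_levy D_subordinator) w).
exact: (subordinator_nondecreasing D_subordinator).
Qed.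

Let mN u : 0 <= u -> measurable_fun setT (N u).
Proof. exact: counting_measurable (poisson_counting N_poisson) _. Qed.

Let N_right_cont w u : 0 <= u ->
  (N s w)%:R @[s --> u^'+] --> ((N u w)%:R : R).
Proof. by have [+ _] := counting_cadlag (poisson_counting N_poisson) w; exact. Qed.

Let indepND t : 0 <= t -> forall u (A : set R) k, 0 <= u -> measurable A ->
  P (D t @^-1` A `&` N u @^-1` [set k]) =
  (P (D t @^-1` A) * P (N u @^-1` [set k]))%E.
Proof.
move=> t0 u A k u0 mA; rewrite setIC muleC.
by apply: N_D_independent; exact: process_sigma_algebra_preimage.
Qed.

Lemma measurable_subordinated_poisson t : 0 <= t ->
  measurable_fun setT (subordinated_poisson N D t).
Proof.
move=> t0; apply: (@measurable_random_time _ _ _ N (D t)) => //.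
- exact: mD.
- by move=> w; exact: D_ge0.
Qed.

Lemma pgf_subordinated_poisson t z : 0 <= t -> 0 < z <= 1 ->
  pgf P (subordinated_poisson N D t) z =
  (expR (- (t * f (lambda * (1 - z)))))%:E.
Proof.
move=> t0 z01; have lz0 : 0 <= lambda * (1 - z).
  by case/andP: z01 => _ z1; rewrite mulr_ge0 ?subr_ge0// ltW.
(* The Laplace transform of [D t] is taken at [lambda * (1 - z)], which is nonnegative because
   [z <= 1]. *)
rewrite -(subordinator_laplace D_subordinator lz0 t0) unlock.
rewrite [LHS](@pgf_random_time _ _ _ P N (D t) (fun z => lambda * (1 - z)))//.
- move=> y u /andP[y0 y1] u0; rewrite (@pgf_poisson _ _ _ P (N u) (lambda * u)) //.
  + by rewrite mulrAC.
  + by rewrite mulr_ge0// ltW.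
  + exact: (poisson_marginal N_poisson).
- exact: mD.
- by move=> w; exact: D_ge0.
- exact: indepND.
Qed.

End subordination.

(** * Equality in law of the geometric subordinated process and the random sum *)

Theorem proposition3p2 (d : measure_display) (T : measurableType d)
    (R : realType) (P : probability T R)
    (b : R) (nu : {measure set R -> \bar R})
    (lambda mu : R)
    (D : R -> T -> R) (N G : R -> T -> nat) (Y : nat -> T -> nat)
    (b_ge0 : 0 <= b)
    (nu_levy : levy_measure_pos nu)
    (nu_infinite : nu `]0, +oo[%classic = +oo%E)
    (D_subordinator : levy_subordinator P (bernstein_fun b nu) D)
    (lambda_gt0 : 0 < lambda)
    (N_poisson : poisson_process P lambda N)
    (N_D_independent : independent_processes P N D)
    (mu_gt0 : 0 < mu)
    (G_geometric : geometric_counting_process P mu G)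
    (G_Nf_independent :
      independent_processes P G (subordinated_poisson N D))
    (Y_law : forall i, eq_in_law P (Y i) (subordinated_poisson N D 1))
    (Y_independent : mutually_independent P Y)
    (Y_G_independent :
      independent_sigma_algebras P
        (generated_sigma_algebra [set: nat] Y) (process_sigma_algebra G)) :
  forall t : R, 0 <= t ->
    eq_in_law P (geometric_subordinated_poisson N D G t)
                (fun w => (\sum_(i < G t w) Y i w)%N).
Proof.
move=> t t0.
have mY i : measurable_fun setT (Y i) by have [] := Y_law i.
have mS n := measurable_nat_sum n mY.
have mNf n : measurable_fun setT (subordinated_poisson N D n%:R).
  by apply: (measurable_subordinated_poisson D_subordinator N_poisson).
have mG : measurable_fun setT (G t).
  exact: (counting_measurable (mixed_poisson_counting G_geometric)).
split; [exact: (measurable_random_index mG mNf)|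
        exact: (measurable_random_index mG mS)|].
move=> A mA.
have GS n : process_sigma_algebra G (G t @^-1` [set n]).
  exact: process_sigma_algebra_preimage.
(* Both probabilities become series over the values [n] of [G t]; each independence hypothesis is
   used for one side. *)
rewrite (probability_random_index (X := G t)
  (Z := fun n => subordinated_poisson N D n%:R))//; last first.
  move=> n; apply: G_Nf_independent; first exact: GS.
  exact: process_sigma_algebra_preimage.
rewrite (probability_random_index (X := G t)
  (Z := fun n w => \sum_(i < n) Y i w)%N)//; last first.
  move=> n; rewrite setIC muleC; apply: Y_G_independent; last exact: GS.
  exact: generated_sigma_algebra_sum.
apply: eq_eseriesr => n _; congr (_ * _)%E.
apply: pgf_inj => // z z01; have /andP[z0 _] := z01.
have pgfNf := pgf_subordinated_poisson D_subordinator lambda_gt0 N_poisson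
  N_D_independent.
(* The common generating function of the [Y i] is that of the subordinated variable at time 1. *)
rewrite (@pgf_sum _ _ _ P Y z
  (expR (- bernstein_fun b nu (lambda * (1 - z))))) ?(ltW z0)//; last first.
  move=> i; rewrite -[bernstein_fun _ _ _]mul1r -(pgfNf 1 z)//.
  exact: eq_in_law_pgf (ltW z0) (Y_law i).
(* At time [n] the exponent is [n] times the one at time 1, so the exponential is the [n]-th
   power. *)
by rewrite pgfNf// -expRM_natl -mulrN.
Qed.
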